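(* Let the smooth component $f$ of the problem $\min_{x\in Q}\{F(x)=f(x)+\psi(x)\}$ be Quasi-Self-Concordant with parameter $M>0$, and let $x^\star$ be a solution of this problem. Then, for the iterations of the Dual Newton Method $\mathscr D(f,\psi,x_0,M,\nu)$ described in the context, with tolerance $\nu>0$, we have the global linear rate $$\|F'(x_k)\|_*\ \le\ \exp\Bigl(2M^2\bigl(\|x_0-x^\star\|+2\nu\bigr)^2-\frac k2\Bigr)\|F'(x_0)\|_*,\qquad k\ge1.$$ Moreover, during the first $k$ iterations of the method, the total number $N_k$ of second-order oracle calls (executions of Step 2-a) is bounded as $$N_k\ \le\ k\cdot\Bigl(1+\frac1{\ln2}\ln\ln\frac{(k+1)^2}{2M\nu}\Bigr).$$
   Context: $\mathbb{E}$ is a finite-dimensional real vector space with dual $\mathbb{E}^*$; $\langle s,x\rangle$ denotes the value of $s\in\mathbb{E}^*$ at $x\in\mathbb{E}$. A self-adjoint positive-definite operator $B:\mathbb{E}\to\mathbb{E}^*$ is fixed, with norms $\|h\|=\langle Bh,h\rangle^{1/2}$ on $\mathbb{E}$ and $\|s\|_*=\langle s,B^{-1}s\rangle^{1/2}$ on $\mathbb{E}^*$. For $x\in Q$ write $\|h\|_x=\langle\nabla^2f(x)h,h\rangle^{1/2}$. Problem: $\min_{x\in Q}\{F(x)=f(x)+\psi(x)\}$, where $\psi:\mathbb{E}\to\mathbb{R}\cup\{+\infty\}$ is a simple closed convex proper function, $Q=\operatorname{dom}\psi$, and $f:Q\to\mathbb{R}$ is convex and several times differentiable, with gradient $\nabla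 f(x)$, Hessian $\nabla^2f(x)\succeq0$ and third derivative $D^3f(x)$ (a symmetric trilinear form). A solution of the problem exists. $f$ is Quasi-Self-Concordant with parameter $M$ if $D^3f(x)[u,u,v]\le M\|u\|_x^2\|v\|$ for all $x$ in the domain of $f$ and all $u,v\in\mathbb{E}$. $\partial F(x)$ is the convex subdifferential of $F$. Dual Newton Method $\mathscr D(f,\psi,x_0,M,\nu)$: initialize $g_0=\|F'(x_0)\|_*$ for some $F'(x_0)\in\partial F(x_0)$, $x_0\in Q$. For $k\ge0$ iterate: (1) Set $z_0=x_k$. (2) For $t\ge0$ iterate: (2-a) compute $$z_{t+1}=\arg\min_{y\in Q}\Bigl\{\langle\nabla f(z_t),y-z_t\rangle+\tfrac12\|y-z_t\|_{z_t}^2+Mg_k\|y-x_k\|^2+\psi(y)\Bigr\};$$ (2-b) set $s_{t+1}=\nabla f(z_{t+1})-\nabla f(z_t)-\nabla^2f(z_t)(z_{t+1}-z_t)$; until $\|s_{t+1}\|_*\le\frac{2Mg_k\nu}{(k+1)^2}$. (3) Set $x_{k+1}=z_{t+1}$ and $g_{k+1}=\|F'(x_{k+1})\|_*$, where $F'(x_{k+1})=s_{t+1}-2Mg_kB(x_{k+1}-x_k)\in\partial F(x_{k+1})$. (4) If $g_{k+1}\le\nu$, return $x_{k+1}$.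
   Formalization: The bound on N_k is proved under the added condition (k+1)²/(2Mν) ≥ e; otherwise ln ln is undefined or negative, and the bound would fall below k although each iteration makes at least one oracle call. *)

(* Defs.v *)
From HB Require Import structures.
From mathcomp Require Import all_boot all_order all_algebra.
From mathcomp Require Import all_classical all_reals all_analysis.

Set Implicit Arguments.
Unset Strict Implicit.
Unset Printing Implicit Defensive.

Import Order.TTheory GRing.Theory Num.Theory.

Local Open Scope classical_set_scope.
Local Open Scope ring_scope.

Definition dual (R : realType) (E : vectType R) : vectType R := 'Hom(E, R^o).

Definition pairing (R : realType) (E : vectType R) (s : dual E) (x : E) : R :=
  s x.

Definition self_adjoint (R : realType) (E : vectType R)
    (A : 'Hom(E, dual E)) : Prop :=
  forall x y, pairing (A x) y = pairing (A y) x.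

Definition positive_definite (R : realType) (E : vectType R)
    (A : 'Hom(E, dual E)) : Prop :=
  forall x, x != 0 -> 0 < pairing (A x) x.

Definition positive_semidefinite (R : realType) (E : vectType R)
    (A : 'Hom(E, dual E)) : Prop :=
  forall x, 0 <= pairing (A x) x.

(* With A := B this is the norm on E; with A := the Hessian of f at x it is
   the local norm at x. *)
Definition onorm (R : realType) (E : vectType R) (A : 'Hom(E, dual E))
    (h : E) : R :=
  Num.sqrt (pairing (A h) h).

(* [B^-1] is the genuine inverse operator as soon as [B] is positive definite,
   since [B] is then a linear bijection. *)
Definition dnorm (R : realType) (E : vectType R) (B : 'Hom(E, dual E))
    (s : dual E) : R :=
  Num.sqrt (pairing s ((B^-1)%VF s)).

(* Frechet differentiability relative to Q.  [bounded_by v c] stands for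
   "the norm of v is at most c", which avoids taking a supremum for the
   operator norm. *)
Definition frechet_within (R : realType) (E : vectType R)
    (B : 'Hom(E, dual E)) (Q : set E) (G : vectType R)
    (bounded_by : G -> R -> Prop) (phi : E -> G) (x : E) (L : 'Hom(E, G)) :
    Prop :=
  forall eps : R, 0 < eps -> exists2 delta : R, 0 < delta &
    forall y, Q y -> onorm B (y - x) < delta ->
      bounded_by (phi y - phi x - L (y - x)) (eps * onorm B (y - x)).

(* [df], [d2f] and [d3f] are the first three derivatives of f : Q -> R.  When Q
   has empty interior they are not determined by f on Q; they are then any such
   data, in particular those of a smooth extension of f around Q. *)
Record three_times_differentiable (R : realType) (E : vectType R)
    (B : 'Hom(E, dual E)) (Q : set E) (f : E -> R) (df : E -> dual E)
    (d2f : E -> 'Hom(E, dual E)) (d3f : E -> 'Hom(E, 'Hom(E, dual E))) :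
    Prop := ThreeTimesDifferentiable {
  diff_f : forall x, Q x ->
    frechet_within B Q (fun (r : R^o) c => `|r : R| <= c)
      (f : E -> R^o) x (df x);
  diff_df : forall x, Q x ->
    frechet_within B Q (fun (s : dual E) c => dnorm B s <= c) df x (d2f x);
  diff_d2f : forall x, Q x ->
    frechet_within B Q
      (fun (A : 'Hom(E, dual E)) c => forall h, dnorm B (A h) <= c * onorm B h)
      d2f x (d3f x);
  d2f_sym : forall x, Q x -> self_adjoint (d2f x);
  d2f_psd : forall x, Q x -> positive_semidefinite (d2f x);
  d3f_sym : forall x, Q x -> forall u v w,
    pairing (d3f x u v) w = pairing (d3f x v u) w /\
    pairing (d3f x u v) w = pairing (d3f x u w) v }.

Definition quasi_self_concordant (R : realType) (E : vectType R)
    (B : 'Hom(E, dual E)) (Q : set E) (d2f : E -> 'Hom(E, dual E))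
    (d3f : E -> 'Hom(E, 'Hom(E, dual E))) (M : R) : Prop :=
  forall x, Q x -> forall u v,
    pairing (d3f x u u) v <= M * onorm (d2f x) u ^+ 2 * onorm B v.

Definition edom (R : realType) (E : vectType R) (psi : E -> \bar R) : set E :=
  [set x | (psi x < +oo)%E].

Record closed_convex_proper (R : realType) (E : vectType R)
    (B : 'Hom(E, dual E)) (psi : E -> \bar R) : Prop := ClosedConvexProper {
  psi_closed : forall x (a : R), (a%:E < psi x)%E ->
    exists2 delta : R, 0 < delta &
      forall y, onorm B (y - x) < delta -> (a%:E < psi y)%E;
  psi_convex : forall (x y : E) (t : R), 0 < t -> t < 1 ->
    (psi (t *: x + (1 - t) *: y)%R <= t%:E * psi x + (1 - t)%:E * psi y)%E;
  psi_not_ninfty : forall x, psi x != -oo%E;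
  psi_proper : edom psi !=set0 }.

(* Equal to +oo off the domain of psi, whatever the junk value of f there. *)
Definition objective (R : realType) (E : vectType R) (f : E -> R)
    (psi : E -> \bar R) (x : E) : \bar R :=
  ((f x)%:E + psi x)%E.

Definition is_argmin (R : realType) (E : vectType R) (Q : set E)
    (phi : E -> \bar R) (z : E) : Prop :=
  Q z /\ forall y, Q y -> (phi z <= phi y)%E.

Definition subdifferential (R : realType) (E : vectType R)
    (F : E -> \bar R) (x : E) : set (dual E) :=
  [set s | edom F x /\ forall y, (F x + (pairing s (y - x))%:E <= F y)%E].

Definition newton_model (R : realType) (E : vectType R)
    (B : 'Hom(E, dual E)) (df : E -> dual E) (d2f : E -> 'Hom(E, dual E))
    (psi : E -> \bar R) (M g : R) (x z y : E) : \bar R :=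
  ((pairing (df z) (y - z) + 2^-1 * onorm (d2f z) (y - z) ^+ 2
    + M * g * onorm B (y - x) ^+ 2)%:E + psi y)%E.

Definition newton_residual (R : realType) (E : vectType R)
    (df : E -> dual E) (d2f : E -> 'Hom(E, dual E)) (z z' : E) : dual E :=
  df z' - df z - d2f z (z' - z).

(* A snapshot of the method: [outer] = k iterations are completed, [center] is
   x_k, [slope] is F'(x_k) (so that g_k is its dual norm), [inner] = t
   executions of Step (2-a) were made in the iteration in progress, [iterate]
   is z_t, and [calls] counts all the executions of Step (2-a) so far. *)
Record dnm_state (R : realType) (E : vectType R) := DnmState {
  outer : nat;
  center : E;
  slope : dual E;
  inner : nat;
  iterate : E;
  calls : nat }.

(* The snapshots reachable by the Dual Newton Method.  The first premise of the
   two last constructors says that the method has not returned: it returns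
   x_k when g_k <= nu for some k >= 1, while g_0 is never tested. *)
Inductive dnm_reachable (R : realType) (E : vectType R)
    (B : 'Hom(E, dual E)) (df : E -> dual E) (d2f : E -> 'Hom(E, dual E))
    (psi : E -> \bar R) (M nu : R) (x0 : E) (dF0 : dual E) :
    dnm_state E -> Prop :=
| DnmInit :
    dnm_reachable B df d2f psi M nu x0 dF0 (DnmState 0%N x0 dF0 0%N x0 0%N)
| DnmInner k x dF t z N z' :
    dnm_reachable B df d2f psi M nu x0 dF0 (DnmState k x dF t z N) ->
    k = 0%N \/ nu < dnorm B dF ->
    is_argmin (edom psi) (newton_model B df d2f psi M (dnorm B dF) x z) z' ->
    2 * M * dnorm B dF * nu / k.+1%:R ^+ 2 <
      dnorm B (newton_residual df d2f z z') ->
    dnm_reachable B df d2f psi M nu x0 dF0 (DnmState k x dF t.+1 z' N.+1)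
| DnmOuter k x dF t z N z' :
    dnm_reachable B df d2f psi M nu x0 dF0 (DnmState k x dF t z N) ->
    k = 0%N \/ nu < dnorm B dF ->
    is_argmin (edom psi) (newton_model B df d2f psi M (dnorm B dF) x z) z' ->
    dnorm B (newton_residual df d2f z z') <=
      2 * M * dnorm B dF * nu / k.+1%:R ^+ 2 ->
    dnm_reachable B df d2f psi M nu x0 dF0
      (DnmState k.+1 z'
        (newton_residual df d2f z z' - (2 * M * dnorm B dF) *: B (z' - x))
        0%N z' N.+1).

(* Number of iterations that have executed Step (2-a) at least once, the one in
   progress included. *)
Definition started (R : realType) (E : vectType R) (st : dnm_state E) : nat :=
  (outer st + (0 < inner st))%N.

(* Main.v *)
Require Import Defs.
From HB Require Import structures.
From mathcomp Require Import all_boot all_order all_algebra.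
From mathcomp Require Import all_classical all_reals all_analysis.
From mathcomp Require Import ring lra.

Set Implicit Arguments.
Unset Strict Implicit.
Unset Printing Implicit Defensive.

Import Order.TTheory GRing.Theory Num.Theory.
Import numFieldNormedType.Exports.

Local Open Scope classical_set_scope.
Local Open Scope ring_scope.

(** Each outer iteration is an inexact proximal-point step: with
    [lambda = 2 M g_k], the new slope is [s - lambda B (x_(k+1) - x_k)], where
    the residual [s] of the inner loop has size at most [lambda nu / (k + 1)^2].
    The new slope is a subgradient of [F], so it has nonnegative product with
    [x_(k+1) - x*], and expanding one square ([proximal_step]) gives
      [r_(k+1)^2 + (g_(k+1) / (2 M g_k))^2 <= (r_k + nu / (k + 1)^2)^2]
    for the distances [r_k = |x_k - x*|]. Adding to [r_k] the tail
    [2 nu / (k + 1)] absorbs the tolerances, and the squares telescope: the sum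
    of the [(g_(k+1) / g_k)^2] is at most [4 M^2 (r_0 + 2 nu)^2]. Since
    [q^2 <= exp (q^2 - 1)], the product of the first [k] ratios is at most
    [exp (2 M^2 (r_0 + 2 nu)^2 - k / 2)]. The induction [slope_decay] carries
    this computation with the potential [r_k + 2 nu / (k + 1)].

    The inner loop is Newton's method on [f + M g_k |. - x_k|^2 + psi], whose
    slope at [z_t] is the residual [s_t], with [s_0 = F'(x_k)]. A step [d] from
    slope [s] satisfies [|d|_z^2 + 2 M g_k |d|^2 <= |s| |d|]
    ([newton_decrease]), and quasi-self-concordance, a linear differential
    inequality for the Hessian along the segment, bounds the next residual by
    [(M / 2) exp (M |d|) |d|_z^2] ([newton_residual_le]). As [|s_0| = g_k],
    together they give [|s_(t+1)| / g_k <= e^(-2) (|s_t| / g_k)^2]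
    ([newton_contraction]), hence [|s_t| <= exp (- 2^t) g_k] for [t >= 1]. A
    tolerance that fails at [t] thus forces [2^t < ln ((k + 1)^2 / (2 M nu))],
    and each iteration makes one call more than its last failing index.

    The domain of [psi] may have empty interior, so all differentiation is done
    on the parameter interval of a segment of the domain. *)

(** * The duality pairing and the norms of an operator *)

Section Norms.
Context {R : realType} {E : vectType R}.
Implicit Types (s : dual E) (x y h : E) (A : 'Hom(E, dual E)) (a : R).

Lemma pairingDl s s' x : pairing (s + s') x = pairing s x + pairing s' x.
Proof. by rewrite /pairing add_lfunE. Qed.

Lemma pairingNl s x : pairing (- s) x = - pairing s x.
Proof. by rewrite /pairing opp_lfunE. Qed.

Lemma pairingZl a s x : pairing (a *: s) x = a * pairing s x.
Proof. by rewrite /pairing scale_lfunE. Qed.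

Lemma pairingDr s x y : pairing s (x + y) = pairing s x + pairing s y.
Proof. by rewrite /pairing linearD. Qed.

Lemma pairingNr s x : pairing s (- x) = - pairing s x.
Proof. by rewrite /pairing linearN. Qed.

Lemma pairingZr a s x : pairing s (a *: x) = a * pairing s x.
Proof. by rewrite /pairing linearZ. Qed.

Lemma pairing0l x : pairing (0 : dual E) x = 0.
Proof. by rewrite /pairing lfunE. Qed.

Definition pairing_linear :=
  (pairingDl, pairingNl, pairingZl, pairingDr, pairingNr, pairingZr).

Lemma onorm_ge0 A h : 0 <= onorm A h.
Proof. exact: sqrtr_ge0. Qed.

Lemma onorm_sqr A h : positive_semidefinite A ->
  onorm A h ^+ 2 = pairing (A h) h.
Proof. by move=> A_psd; rewrite sqr_sqrtr. Qed.

Lemma onorm_scale A a h : onorm A (a *: h) = `|a| * onorm A h.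
Proof.
rewrite /onorm linearZ/= pairingZl pairingZr mulrA -expr2.
by rewrite sqrtrM ?sqr_ge0// sqrtr_sqr.
Qed.

Lemma onormN A h : onorm A (- h) = onorm A h.
Proof. by rewrite -scaleN1r onorm_scale normrN1 mul1r. Qed.

Lemma positive_definite_semi A :
  positive_definite A -> positive_semidefinite A.
Proof.
move=> A_pd x; have [->|/A_pd/ltW//] := eqVneq x 0.
by rewrite linear0 pairing0l.
Qed.

Lemma pairing_expand A x y a : self_adjoint A ->
  pairing (A (x + a *: y)) (x + a *: y) =
    pairing (A x) x + 2 * a * pairing (A x) y + a ^+ 2 * pairing (A y) y.
Proof.
move=> A_sym; rewrite linearD linearZ/= !pairing_linear (A_sym y x); ring.
Qed.

Variable B : 'Hom(E, dual E).
Hypothesis B_sym : self_adjoint B.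
Hypothesis B_pd : positive_definite B.

Let B_psd := positive_definite_semi B_pd.

(** The discriminant of [t |-> |t x + y|^2], evaluated at its minimizer. *)
Lemma cauchy_schwarz x y : pairing (B x) y <= onorm B x * onorm B y.
Proof.
have [->|x0] := eqVneq x 0.
  by rewrite /onorm !linear0 !pairing0l sqrtr0 mul0r.
have Bx_gt0 := B_pd x0.
rewrite (le_trans (ler_norm _))// -(ler_pXn2r (n := 2)) ?nnegrE//;
  last by rewrite mulr_ge0 ?onorm_ge0.
rewrite real_normK ?num_real// exprMn !onorm_sqr//.
have := B_psd (pairing (B x) x *: y - pairing (B x) y *: x).
rewrite linearB !linearZ/= !pairing_linear (B_sym y x).
set a := pairing (B x) x in Bx_gt0 *; set b := pairing (B x) y.
set c := pairing (B y) y => disc.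
rewrite -subr_ge0 -(pmulr_rge0 _ Bx_gt0); apply: le_trans disc _.
rewrite le_eqVlt; apply/orP; left; apply/eqP.
clearbody a b c; ring.
Qed.

Lemma onorm_triangle x y : onorm B (x + y) <= onorm B x + onorm B y.
Proof.
rewrite -(ler_pXn2r (n := 2)) ?nnegrE ?addr_ge0 ?onorm_ge0//.
rewrite sqrrD !onorm_sqr// linearD/= !pairing_linear (B_sym y x).
have := cauchy_schwarz x y; lra.
Qed.

(** A positive definite operator is injective, and [E] and its dual have the
    same dimension. *)
Lemma BinvK s : B ((B^-1)%VF s) = s.
Proof.
apply: limg_lfunVK.
suff -> : limg B = fullv by rewrite memvf.
have kerB : lker B == 0%VS.
  apply/lker0P => x y Bxy; apply/eqP; rewrite -subr_eq0; apply/negP => /negP xy.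
  by have := B_pd xy; rewrite linearB/= Bxy subrr pairing0l ltxx.
apply/eqP; rewrite eqEdim subvf/= limg_dim_eq ?(eqP kerB) ?capv0//.
by rewrite !dimvf /dim/= muln1.
Qed.

Lemma dnorm_nonneg s : 0 <= dnorm B s.
Proof. exact: sqrtr_ge0. Qed.

Lemma dnormE s : dnorm B s = onorm B ((B^-1)%VF s).
Proof. by rewrite /onorm BinvK. Qed.

Lemma dnorm_B h : dnorm B (B h) = onorm B h.
Proof.
suff BK : (B^-1)%VF (B h) = h by rewrite dnormE BK.
apply/eqP; rewrite -subr_eq0; apply/negP => /negP /B_pd.
by rewrite linearB/= BinvK subrr pairing0l ltxx.
Qed.

Lemma dnorm_scale a s : dnorm B (a *: s) = `|a| * dnorm B s.
Proof. by rewrite !dnormE linearZ/= onorm_scale. Qed.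

Lemma pairing_le s h : pairing s h <= dnorm B s * onorm B h.
Proof. by rewrite -{1}(BinvK s) dnormE cauchy_schwarz. Qed.

Lemma pairing_abs_le s h : `|pairing s h| <= dnorm B s * onorm B h.
Proof.
by rewrite ler_norml pairing_le lerNl -pairingNr -(onormN B h) pairing_le.
Qed.

Lemma dnorm_le s c : 0 <= c ->
  (forall v, pairing s v <= c * onorm B v) -> dnorm B s <= c.
Proof.
move=> c0 sc; have [->//|s0] := eqVneq (dnorm B s) 0.
have s_gt0 : 0 < dnorm B s by rewrite lt_def s0 dnorm_nonneg.
rewrite -(ler_pM2r s_gt0) {3}dnormE; apply: le_trans (sc _).
by rewrite -expr2 dnormE onorm_sqr// BinvK.
Qed.

End Norms.

(** * Derivatives along a segment *)

Section UnitInterval.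
Context {R : realType}.
Implicit Types (u v phi dphi : R -> R) (t l : R).

(** The derivative relative to the unit interval: one-sided at the endpoints. It
    is what differentiability relative to a convex set gives along a segment. *)
Definition deriv01 phi t l := forall eps, 0 < eps -> exists2 delta, 0 < delta &
  forall t', 0 <= t' <= 1 -> `|t' - t| < delta ->
    `|phi t' - phi t - l * (t' - t)| <= eps * `|t' - t|.

Lemma deriv01_is_derive phi t l : 0 < t < 1 -> deriv01 phi t l ->
  is_derive t (1 : R) phi l.
Proof.
move=> /andP[t0 t1] phi_l.
suff q_l : (fun h => h^-1 *: ((phi \o shift t) (h *: 1) - phi t)) @ 0^' --> l.
  by apply: DeriveDef; [exact: cvgP q_l|exact: cvg_lim q_l].
apply/cvgrPdist_le => eps eps0; have [d d0 phi_d] := phi_l _ eps0.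
near=> h.
have h0 : h != 0 by near: h; exact: nbhs_dnbhs_neq.
have hd : `|h| < d by near: h; exact: dnbhs0_lt.
have ht : `|h| < t by near: h; exact: dnbhs0_lt.
have ht1 : `|h| < 1 - t by near: h; apply: dnbhs0_lt; rewrite subr_gt0.
have /= := phi_d (h + t); rewrite addrK => /(_ _ hd) phi_h.
move: ht ht1; rewrite !ltr_norml => /andP[? ?] /andP[? ?].
have {}phi_h := phi_h ltac:(lra).
rewrite /= [h%:A]mulr1.
have -> : l - h^-1 *: (phi (h + t) - phi t) =
    - (h^-1 * (phi (h + t) - phi t - l * h)).
  by rewrite /GRing.scale/=; field.
by rewrite normrN normrM normfV mulrC ler_pdivrMr ?normr_gt0.
Unshelve. all: by end_near. Qed.

Lemma deriv01_continuous phi dphi :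
  (forall t, 0 <= t <= 1 -> deriv01 phi t (dphi t)) ->
  {within `[0, 1], continuous phi}.
Proof.
move=> phi_d; apply/subspace_continuousP => t /=; rewrite in_itv/= => t01.
apply/cvgrPdist_le => eps eps0; have [d d0 phi_t] := phi_d t t01 _ ltr01.
near=> t'.
have t'01 : 0 <= t' <= 1.
  have : t' \in `[0, 1] by near: t'; exact: withinT.
  by rewrite in_itv.
have tt' : `|t' - t| < d.
  near: t'; apply: cvg_within.
  by exists d => //= y; rewrite /ball_ distrC.
have tt'_eps : `|t' - t| < eps / (1 + `|dphi t|).
  near: t'; apply: cvg_within.
  exists (eps / (1 + `|dphi t|)); first by rewrite /= divr_gt0// ltr_pwDl.
  by move=> y; rewrite /ball_ /= distrC.
have phi_tt' := phi_t _ t'01 tt'; rewrite mul1r in phi_tt'.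
rewrite ltr_pdivlMr ?ltr_pwDl// mulrDr mulr1 in tt'_eps.
rewrite distrC -(subrK (dphi t * (t' - t)) (phi t' - phi t)).
apply: le_trans (ler_normD _ _) _; rewrite normrM.
by rewrite [_ * `|t' - t|]mulrC; lra.
Unshelve. all: by end_near. Qed.

(** Mean value inequality against a comparison function that is smooth
    everywhere. *)
Lemma deriv01_le phi dphi u du :
    (forall t, 0 <= t <= 1 -> deriv01 phi t (dphi t)) ->
    (forall t, is_derive t (1 : R) u (du t)) ->
    (forall t, 0 <= t <= 1 -> dphi t <= du t) ->
  forall t, 0 <= t <= 1 -> phi t - phi 0 <= u t - u 0.
Proof.
move=> phi_d u_d dphi_du t /andP[t0 t1].
have u_c : {within `[0, 1], continuous u}.
  by apply: derivable_within_continuous => x _; case: (u_d x).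
have /(@continuous_subspaceW _ _ `[0, t]) c :=
  within_continuousB (deriv01_continuous phi_d) u_c.
have [x|x|y] := @MVT_segment _ (phi - u) (dphi - du) 0 t t0.
- rewrite in_itv/= => /andP[x0 xt].
  apply: is_deriveB; apply: deriv01_is_derive; first by rewrite x0; lra.
  by apply: phi_d; lra.
- by apply: c => z/=; rewrite !in_itv/= => /andP[-> ?]; lra.
rewrite in_itv/= => /andP[y0 yt]; rewrite !fctE subr0.
have : (dphi y - du y) * t <= 0.
  by rewrite mulr_le0_ge0// subr_le0; apply: dphi_du; lra.
by lra.
Qed.

Lemma is_derive_quadratic (b c t : R) :
  is_derive t (1 : R) (fun t => b * t + c / 2 * (t * t)) (b + c * t).
Proof.
have id_d := is_derive_id t (1 : R).
have sqr_d : is_derive t (1 : R) (fun t : R => t * t) (t + t).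
  by apply: (is_derive_eq (is_deriveM id_d id_d)); rewrite /GRing.scale/= mulr1.
have lin_d : is_derive t (1 : R) (fun t : R => b * t) b.
  apply: (is_derive_eq (is_deriveZ (f := id) b id_d)).
  by rewrite /GRing.scale/= mulr1.
apply: (is_derive_eq (is_deriveD lin_d (is_deriveZ (c / 2) sqr_d))).
by rewrite /GRing.scale/=; field.
Qed.

Lemma deriv01_le_quadratic phi dphi b c :
    (forall t, 0 <= t <= 1 -> deriv01 phi t (dphi t)) ->
    (forall t, 0 <= t <= 1 -> dphi t <= b + c * t) ->
  forall t, 0 <= t <= 1 -> phi t <= phi 0 + b * t + c / 2 * (t * t).
Proof.
move=> phi_d dphi_le t t01.
have := deriv01_le phi_d (is_derive_quadratic b c) dphi_le t01; lra.
Qed.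

(** Gronwall: [phi t * exp (- c t)] is nonincreasing. *)
Lemma deriv01_gronwall phi dphi c :
    (forall t, 0 <= t <= 1 -> deriv01 phi t (dphi t)) ->
    (forall t, 0 <= t <= 1 -> dphi t <= c * phi t) ->
  forall t, 0 <= t <= 1 -> phi t <= phi 0 * expR (c * t).
Proof.
move=> phi_d dphi_le t /andP[t0 t1].
pose u s := expR (- c * s).
have u_d s : is_derive s (1 : R) u (u s * - c).
  have := @is_derive1_comp _ expR ( *%R (- c)) s _ (- c) (is_derive_expR _) _.
  by apply; apply: is_derive_eq; rewrite /GRing.scale/= mulr1.
have uphi_c : {within `[0, t], continuous phi \* u}.
  move=> x; apply: cvgM.
    apply: (@continuous_subspaceW _ _ `[0, t] `[0, 1]).
      by move=> y/=; rewrite !in_itv/= => /andP[-> ?]; lra.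
    exact: deriv01_continuous phi_d.
  by apply: derivable_within_continuous => y _; case: (u_d y).
have [x|x|y] := @MVT_segment _ (phi \* u)
    (fun s => phi s *: (u s * - c) + u s *: dphi s) 0 t t0.
- rewrite in_itv/= => /andP[x0 xt].
  apply: is_deriveM; apply: deriv01_is_derive; first by rewrite x0; lra.
  by apply: phi_d; lra.
- exact: uphi_c.
rewrite in_itv/= => /andP[y0 yt]; rewrite subr0 /= => phi_u.
have u0 : u 0 = 1 by rewrite /u mulr0 expR0.
have -> : expR (c * t) = (u t)^-1 by rewrite /u mulNr expRN invrK.
rewrite ler_pdivlMr ?expR_gt0// -[phi 0]mulr1 -u0 -subr_le0.
have -> : phi t * u t - phi 0 * u 0 = u y * (dphi y - c * phi y) * t.
  by rewrite [LHS]phi_u /GRing.scale/=; ring.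
rewrite mulr_le0_ge0// mulr_ge0_le0 ?expR_ge0// subr_le0.
by apply: dphi_le; lra.
Qed.

End UnitInterval.

Section Segment.
Context {R : realType} {E : vectType R}.
Variables (B : 'Hom(E, dual E)) (Q : set E).

Definition segment (x y : E) (t : R) : E := x + t *: (y - x).

Definition convex_domain := forall x y t, Q x -> Q y -> 0 <= t <= 1 ->
  Q (segment x y t).

Hypothesis Q_convex : convex_domain.

Lemma segment0 x y : segment x y 0 = x.
Proof. by rewrite /segment scale0r addr0. Qed.

Lemma segment1 x y : segment x y 1 = y.
Proof. by rewrite /segment scale1r addrCA subrr addr0. Qed.

Lemma segmentB x y t t' :
  segment x y t' - segment x y t = (t' - t) *: (y - x).
Proof. by rewrite /segment opprD addrACA subrr add0r scalerBl. Qed.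

(** Chain rule for the scalar reading [l] of a vector-valued map. It serves for
    [f], its gradient paired with a vector, and its Hessian paired with two. *)
Lemma frechet_deriv01 (G : vectType R) (bb : G -> R -> Prop) (phi : E -> G)
    (l : G -> R) (K : R) (x y : E) (t : R) (L : 'Hom(E, G)) :
    (forall a g g', l (a *: g + g') = a * l g + l g') ->
    0 <= K -> (forall g c, bb g c -> `|l g| <= K * c) ->
    Q x -> Q y -> 0 <= t <= 1 ->
    frechet_within B Q bb phi (segment x y t) L ->
  deriv01 (fun t => l (phi (segment x y t))) t (l (L (y - x))).
Proof.
move=> l_lin K0 l_bb Qx Qy t01 phiL eps eps0.
pose h := y - x; pose b := onorm B h; have b0 : 0 <= b by exact: onorm_ge0.
have Kb0 : 0 <= K * b by exact: mulr_ge0.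
have [|d d0 phi_d] := phiL (eps / (1 + K * b)).
  by rewrite divr_gt0// ltr_wpDr.
exists (d / (1 + b)); first by rewrite divr_gt0// ltr_wpDr.
move=> t' t'01; rewrite ltr_pdivlMr ?ltr_wpDr// mulrDr mulr1 => tt'.
have := phi_d (segment x y t') (Q_convex Qx Qy t'01).
rewrite segmentB onorm_scale -/h -/b => /(_ _)/l_bb.
have lB g g' : l (g - g') = l g - l g'.
  by rewrite addrC -scaleN1r l_lin mulN1r addrC.
have lZ a g : l (a *: g) = a * l g.
  have l0 : l 0 = 0 by rewrite -(subrr 0) lB subrr.
  by rewrite -[a *: g]addr0 l_lin l0 addr0.
rewrite linearZ !lB lZ [_ * l (L h)]mulrC => phi_t.
apply: le_trans (phi_t _) _.
  by apply: le_lt_trans tt'; rewrite lerDr.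
have -> : K * (eps / (1 + K * b) * (`|t' - t| * b)) =
    (K * b) / (1 + K * b) * (eps * `|t' - t|) by ring.
rewrite ler_piMl ?mulr_ge0 ?(ltW eps0)//.
by rewrite ler_pdivrMr ?ltr_wpDr// mul1r lerDr.
Qed.

End Segment.

(** * First-order optimality for composite functions *)

Section Optimality.
Context {R : realType} {E : vectType R}.
Variable Q : set E.
Implicit Types (psi G : E -> R) (x y : E) (c s : dual E).

Definition convex_along psi := forall x y t, Q x -> Q y -> 0 <= t <= 1 ->
  psi (segment x y t) <= (1 - t) * psi x + t * psi y.

Definition subgradient psi x s :=
  forall y, Q y -> psi x + pairing s (y - x) <= psi y.

(** Compare [x] with a point moved slightly towards [y]: [G] changes to first
    order by its derivative, [psi] by at most the corresponding fraction of
    [psi y - psi x]. *)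
Lemma composite_optimality psi G x c :
    convex_domain Q -> convex_along psi -> Q x ->
    (forall y, Q y ->
       deriv01 (fun t => G (segment x y t)) 0 (pairing c (y - x))) ->
    (forall y, Q y -> G x + psi x <= G y + psi y) ->
  subgradient psi x (- c).
Proof.
move=> Qcvx psi_cvx Qx G_c x_min y Qy; rewrite pairingNl leNgt; apply/negP.
set p := pairing c (y - x) => lt_psi.
have [|d d0 G_d] := G_c y Qy ((psi x - p - psi y) / 2); first by lra.
have [t /andP[t0 t1] td] : exists2 t, 0 < t <= 1 & t < d.
  exists (Num.min 1 (d / 2)); first by rewrite lt_min ltr01 ge_min lexx /=; lra.
  by rewrite gt_min; apply/orP; right; lra.
have t01 : 0 <= t <= 1 by rewrite (ltW t0).
have := G_d t t01; rewrite subr0 segment0 gtr0_norm// => /(_ td).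
rewrite ler_norml -/p => /andP[_ G_t].
have := x_min _ (Qcvx _ _ _ Qx Qy t01); have := psi_cvx _ _ _ Qx Qy t01.
by nra.
Qed.

Lemma deriv01D (phi1 phi2 : R -> R) t l1 l2 :
  deriv01 phi1 t l1 -> deriv01 phi2 t l2 ->
  deriv01 (fun t => phi1 t + phi2 t) t (l1 + l2).
Proof.
move=> d1 d2 eps eps0; have eps2 : 0 < eps / 2 by rewrite divr_gt0.
have [e1 e10 {}d1] := d1 _ eps2; have [e2 e20 {}d2] := d2 _ eps2.
exists (Num.min e1 e2) => [|t' t'01]; first by rewrite lt_min e10.
rewrite lt_min => /andP[/(d1 _ t'01) d1' /(d2 _ t'01) d2'].
have -> : phi1 t' + phi2 t' - (phi1 t + phi2 t) - (l1 + l2) * (t' - t) =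
  (phi1 t' - phi1 t - l1 * (t' - t)) + (phi2 t' - phi2 t - l2 * (t' - t)).
  by ring.
apply: le_trans (ler_normD _ _) _; lra.
Qed.

Lemma deriv01N (phi : R -> R) t l :
  deriv01 phi t l -> deriv01 (fun t => - phi t) t (- l).
Proof.
move=> d eps /d[e e0 {}d]; exists e => // t' t'01 /(d _ t'01).
by rewrite -normrN; congr (`| _ | <= _); ring.
Qed.

Lemma deriv01_quadratic (p q r : R) :
  deriv01 (fun t => p + t * q + t ^+ 2 * r) 0 q.
Proof.
move=> eps eps0; have r1 : 0 < 1 + `|r| by rewrite ltr_pwDl.
exists (eps / (1 + `|r|)) => [|t _]; first by rewrite divr_gt0.
rewrite subr0 ltr_pdivlMr// => tr.
have -> : p + t * q + t ^+ 2 * r - (p + 0 * q + 0 ^+ 2 * r) - q * t =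
    t * r * t by ring.
rewrite normrM ler_wpM2r// normrM; apply: le_trans (ltW tr).
by rewrite ler_wpM2l// lerDr.
Qed.

End Optimality.

(** * Quasi-self-concordance bounds the Newton residual *)

Section QuasiSelfConcordance.
Context {R : realType} {E : vectType R}.
Variable B : 'Hom(E, dual E).
Hypothesis B_sym : self_adjoint B.
Hypothesis B_pd : positive_definite B.
Variables (Q : set E) (f : E -> R) (df : E -> dual E).
Variables (d2f : E -> 'Hom(E, dual E)) (d3f : E -> 'Hom(E, 'Hom(E, dual E))).
Variable M : R.
Hypothesis Q_convex : convex_domain Q.
Hypothesis f_diff : three_times_differentiable B Q f df d2f d3f.
Hypothesis f_qsc : quasi_self_concordant B Q d2f d3f M.
Hypothesis M_ge0 : 0 <= M.

Lemma deriv01_f x y t : Q x -> Q y -> 0 <= t <= 1 ->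
  deriv01 (fun t => f (segment x y t)) t (pairing (df (segment x y t)) (y - x)).
Proof.
move=> Qx Qy t01.
apply: (frechet_deriv01 (G := R^o) (l := id) (K := 1) Q_convex _ _ _ Qx Qy t01
  (diff_f f_diff (Q_convex Qx Qy t01))) => // g c.
by rewrite mul1r.
Qed.

Lemma deriv01_df x y v t : Q x -> Q y -> 0 <= t <= 1 ->
  deriv01 (fun t => pairing (df (segment x y t)) v) t
    (pairing (d2f (segment x y t) (y - x)) v).
Proof.
move=> Qx Qy t01.
apply: (frechet_deriv01 (l := fun s => pairing s v) (K := onorm B v)
  Q_convex _ _ _ Qx Qy t01 (diff_df f_diff (Q_convex Qx Qy t01))).
- by move=> a g g'; rewrite !pairing_linear.
- exact: onorm_ge0.
- move=> s c sc; apply: le_trans (pairing_abs_le B_sym B_pd s v) _.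
  by rewrite mulrC ler_wpM2l// onorm_ge0.
Qed.

Lemma deriv01_d2f x y h v t : Q x -> Q y -> 0 <= t <= 1 ->
  deriv01 (fun t => pairing (d2f (segment x y t) h) v) t
    (pairing (d3f (segment x y t) (y - x) h) v).
Proof.
move=> Qx Qy t01.
have l_lin (a : R) (g g' : 'Hom(E, dual E)) :
    pairing ((a *: g + g') h) v = a * pairing (g h) v + pairing (g' h) v.
  by rewrite add_lfunE scale_lfunE !pairing_linear.
apply: (frechet_deriv01 (l := fun A : 'Hom(E, dual E) => pairing (A h) v)
  (K := onorm B h * onorm B v)
  Q_convex _ _ _ Qx Qy t01 (diff_d2f f_diff (Q_convex Qx Qy t01))).
- exact: l_lin.
- by rewrite mulr_ge0 ?onorm_ge0.
- move=> A c /(_ h) Ac; apply: le_trans (pairing_abs_le B_sym B_pd _ v) _.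
  by rewrite mulrC [onorm B h * _]mulrC -mulrA ler_wpM2l ?onorm_ge0// mulrC.
Qed.

Lemma d2f_sqr x h : Q x -> onorm (d2f x) h ^+ 2 = pairing (d2f x h) h.
Proof. by move=> /(d2f_psd f_diff) H; rewrite onorm_sqr. Qed.

(** Along a segment, the defining inequality is a linear differential
    inequality for the Hessian form. *)
Lemma hessian_growth x y t : Q x -> Q y -> 0 <= t <= 1 ->
  onorm (d2f (segment x y t)) (y - x) ^+ 2 <=
    onorm (d2f x) (y - x) ^+ 2 * expR (M * onorm B (y - x)).
Proof.
move=> Qx Qy t01; set h := y - x.
have Qxy t' : 0 <= t' <= 1 -> Q (segment x y t') by exact: Q_convex.
pose u s := pairing (d2f (segment x y s) h) h.
have -> : onorm (d2f (segment x y t)) h ^+ 2 = u t.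
  by rewrite d2f_sqr//; exact: Qxy.
have -> : onorm (d2f x) h ^+ 2 = u 0 by rewrite /u segment0 d2f_sqr.
have u0 : 0 <= u 0 by rewrite /u segment0; exact: (d2f_psd f_diff Qx).
pose du s := pairing (d3f (segment x y s) h h) h.
have du_le s : 0 <= s <= 1 -> du s <= M * onorm B h * u s.
  move=> s01; apply: le_trans (f_qsc (Qxy _ s01) _ _) _.
  by rewrite (d2f_sqr h (Qxy _ s01)) -/(u s) -mulrA [u s * _]mulrC mulrA.
have := deriv01_gronwall (fun s => deriv01_d2f h h Qx Qy) du_le t01.
move=> /le_trans; apply; rewrite ler_wpM2l// ler_expR.
by rewrite ler_piMr ?mulr_ge0 ?onorm_ge0//; case/andP: t01.
Qed.

(** The derivative of the Hessian paired with [y - x] and [v] is a third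
    derivative with two equal arguments, the only kind that the hypothesis
    controls; the growth bound makes it uniform along the segment, and it is
    integrated twice. *)
Lemma newton_residual_le x y : Q x -> Q y ->
  dnorm B (newton_residual df d2f x y) <=
    M / 2 * expR (M * onorm B (y - x)) * onorm (d2f x) (y - x) ^+ 2.
Proof.
move=> Qx Qy; set h := y - x; set e := expR _; set u := onorm (d2f x) h ^+ 2.
have e0 : 0 <= e by exact: expR_ge0.
have u0 : 0 <= u by exact: sqr_ge0.
apply: dnorm_le => // [|v].
  by apply: mulr_ge0 => //; apply: mulr_ge0 => //; apply: divr_ge0.
pose c := M * e * u * onorm B v.
have Qxy t' : 0 <= t' <= 1 -> Q (segment x y t') by exact: Q_convex.
pose b t := pairing (d2f (segment x y t) h) v.
have b_le t : 0 <= t <= 1 -> b t <= b 0 + c * t.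
  move=> t01.
  have := deriv01_le_quadratic (b := c) (c := 0)
    (fun s => deriv01_d2f h v Qx Qy) _ t01.
  rewrite !mul0r addr0; apply => s s01.
  rewrite mul0r addr0; apply: le_trans (f_qsc (Qxy _ s01) _ _) _.
  rewrite ler_wpM2r ?onorm_ge0// -mulrA ler_wpM2l// mulrC.
  exact: hessian_growth.
have t01 : 0 <= (1 : R) <= 1 by rewrite ler01 lexx.
have := deriv01_le_quadratic (fun s => deriv01_df v Qx Qy) b_le t01.
rewrite segment1 /b segment0 -/h /newton_residual !pairing_linear /c; lra.
Qed.

End QuasiSelfConcordance.

(** * One step of the method *)

Section EffectiveDomain.
Context {R : realType} {E : vectType R}.
Variables (B : 'Hom(E, dual E)) (psi : E -> \bar R).
Hypothesis psi_ccp : closed_convex_proper B psi.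
Local Notation Q := (edom psi).
Local Notation psir := (fun x => fine (psi x)).

Lemma edom_fineK x : Q x -> psi x = (psir x)%:E.
Proof.
rewrite /edom/= => psi_lt; rewrite fineK// fin_numE (psi_not_ninfty psi_ccp).
by rewrite lt_eqF.
Qed.

Lemma segment_convE (x y : E) (t : R) :
  segment x y t = (1 - t) *: x + t *: y.
Proof. by rewrite /segment scalerBr scalerBl scale1r addrAC addrA. Qed.

Lemma psi_segment x y t : Q x -> Q y -> 0 <= t <= 1 ->
  (psi (segment x y t) <= ((1 - t) * psir x + t * psir y)%:E)%E.
Proof.
move=> Qx Qy /andP[t0 t1].
have [->|t_n0] := eqVneq t 0.
  by rewrite segment0 subr0 mul1r mul0r addr0 edom_fineK.
have [->|t_n1] := eqVneq t 1.
  by rewrite segment1 subrr mul1r mul0r add0r edom_fineK.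
have := psi_convex psi_ccp x y (t := 1 - t); rewrite subKr -segment_convE.
rewrite subr_gt0 lt_def eq_sym t_n1 t1 => /(_ isT).
rewrite gtrBl lt_def t_n0 t0 => /(_ isT).
by rewrite (edom_fineK Qx) (edom_fineK Qy) -!EFinM -EFinD.
Qed.

Lemma edom_convex : convex_domain Q.
Proof.
by move=> x y t Qx Qy t01; apply: le_lt_trans (psi_segment Qx Qy t01) (ltry _).
Qed.

Lemma psi_convex_along : convex_along Q psir.
Proof.
move=> x y t Qx Qy t01; rewrite -lee_fin -edom_fineK; last exact: edom_convex.
exact: psi_segment.
Qed.

Lemma convex_function_along (f : E -> R) :
  convex_function Q f -> convex_along Q f.
Proof.
move=> f_cvx x y t Qx Qy /andP[t0 t1].
have := f_cvx (Itv01 t0 t1) y x; rewrite !inE => /(_ Qy Qx).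
by rewrite convRE /= segment_convE addrC [_ *: x + _]addrC.
Qed.

End EffectiveDomain.

Lemma expR_half_le (R : realType) : expR (1 / 2) <= 16 * expR (- 2) :> R.
Proof.
(* [e^(1/8) <= 8/7] since [e^(-1/8) >= 7/8], and [(8/7)^20 <= 16]. *)
have e8 : expR (1 / 8) <= 8 / 7 :> R.
  have := expR_ge1Dx (- (1 / 8) : R); rewrite expRN => h.
  rewrite -[leLHS]invrK -[leRHS]invrK lef_pV2 ?posrE ?invr_gt0 ?expR_gt0//; lra.
have : expR (1 / 2) * expR 2 <= 16 :> R.
  rewrite -expRD; have -> : 1 / 2 + 2 = 20%:R * (1 / 8) :> R by field.
  rewrite expRM_natl; apply: (@le_trans _ _ ((8 / 7) ^+ 20)).
    by apply: lerXn2r => //; rewrite nnegrE ?expR_ge0//; lra.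
  lra.
by rewrite expRN ler_pdivlMr ?expR_gt0.
Qed.

Section Step.
Context {R : realType} {E : vectType R}.
Variables (B : 'Hom(E, dual E)) (f : E -> R) (df : E -> dual E).
Variables (d2f : E -> 'Hom(E, dual E)) (d3f : E -> 'Hom(E, 'Hom(E, dual E))).
Variables (psi : E -> \bar R) (M : R).
Local Notation Q := (edom psi).
Local Notation psir := (fun x => fine (psi x)).
Hypothesis B_sym : self_adjoint B.
Hypothesis B_pd : positive_definite B.
Hypothesis psi_ccp : closed_convex_proper B psi.
Hypothesis f_convex : convex_function Q f.
Hypothesis f_diff : three_times_differentiable B Q f df d2f d3f.
Hypothesis f_qsc : quasi_self_concordant B Q d2f d3f M.
Hypothesis M_gt0 : 0 < M.

Let Q_convex := edom_convex psi_ccp.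
Let psi_cvx := psi_convex_along psi_ccp.
Let B_psd := positive_definite_semi B_pd.

(** A convex function lies above its tangent: [x] minimizes [- f + f]. *)
Lemma gradient_inequality x y : Q x -> Q y ->
  f x + pairing (df x) (y - x) <= f y.
Proof.
move=> Qx Qy.
have : subgradient Q f x (- - df x).
  apply: (composite_optimality (G := fun x => - f x)) => //.
  - exact: convex_function_along.
  - move=> z Qz; rewrite pairingNl; apply: deriv01N.
    have t01 : 0 <= (0 : R) <= 1 by rewrite lexx ler01.
    by have := deriv01_f Q_convex f_diff Qx Qz t01; rewrite segment0.
  - by move=> z _; rewrite !addNr.
by rewrite opprK; exact.
Qed.

(** [x] minimizes [(f - s) + psi]. *)
Lemma subdifferential_subgradient x s : Q x ->
  subdifferential (objective f psi) x s -> subgradient Q psir x (s - df x).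
Proof.
move=> Qx [_ s_sub]; rewrite -opprB.
apply: (composite_optimality (G := fun y => f y - pairing s y)) => //.
- move=> y Qy; rewrite pairingDl pairingNl; apply: deriv01D.
    have t01 : 0 <= (0 : R) <= 1 by rewrite lexx ler01.
    by have := deriv01_f Q_convex f_diff Qx Qy t01; rewrite segment0.
  have -> : (fun t => - pairing s (segment x y t)) =
      (fun t => - pairing s x + t * - pairing s (y - x) + t ^+ 2 * 0).
    by apply/funext => t; rewrite /segment !pairing_linear; ring.
  exact: deriv01_quadratic.
- move=> y Qy; have := s_sub y; rewrite /objective (edom_fineK psi_ccp Qx).
  rewrite (edom_fineK psi_ccp Qy) -!EFinD lee_fin !pairing_linear; lra.
Qed.

Section Model.
Variables (g : R) (x z z' : E).
Hypothesis g_ge0 : 0 <= g.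
Hypothesis Qz : Q z.
Hypothesis z'_min : is_argmin Q (newton_model B df d2f psi M g x z) z'.

Lemma model_subgradient :
  subgradient Q psir z'
    (- (df z + d2f z (z' - z) + (2 * M * g) *: B (z' - x))).
Proof.
have [Qz' z'_le] := z'_min.
have H_psd := d2f_psd f_diff Qz; have H_sym := d2f_sym f_diff Qz.
pose G y := pairing (df z) (y - z) + 2^-1 * pairing (d2f z (y - z)) (y - z)
  + M * g * pairing (B (y - x)) (y - x).
apply: (composite_optimality (G := G)) => // y Qy.
  pose d := y - z'.
  pose r := 2^-1 * pairing (d2f z d) d + M * g * pairing (B d) d.
  set c := pairing _ _.
  have -> : (fun t => G (segment z' y t)) =
      (fun t => G z' + t * c + t ^+ 2 * r).
    apply/funext => t; rewrite /G /segment.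
    have -> : z' + t *: (y - z') - z = (z' - z) + t *: d by rewrite addrAC.
    have -> : z' + t *: (y - z') - x = (z' - x) + t *: d by rewrite addrAC.
    rewrite !pairing_expand// pairingDr pairingZr /c /r !pairing_linear -/d.
    by field.
  exact: deriv01_quadratic.
have := z'_le y Qy; rewrite /newton_model (edom_fineK psi_ccp Qz').
rewrite (edom_fineK psi_ccp Qy) -!EFinD lee_fin !onorm_sqr//.
Qed.

(** Adding the linearization error of the gradient turns the optimality
    condition of the model into a slope of [F] itself. *)
Lemma step_subgradient :
  subgradient Q psir z'
    (newton_residual df d2f z z' - (2 * M * g) *: B (z' - x) - df z').
Proof.
have -> : newton_residual df d2f z z' - (2 * M * g) *: B (z' - x) - df z' =
    - (df z + d2f z (z' - z) + (2 * M * g) *: B (z' - x)).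
  by rewrite /newton_residual !opprD -!addrA addrC -!addrA addNr addr0.
exact: model_subgradient.
Qed.

(** [s] is the slope at [z] of the regularized objective; monotonicity of the
    subdifferential of [psi], applied to [z] and [z']. *)
Lemma newton_decrease s :
  subgradient Q psir z (s - df z - (2 * M * g) *: B (z - x)) ->
  onorm (d2f z) (z' - z) ^+ 2 + 2 * M * g * onorm B (z' - z) ^+ 2 <=
    dnorm B s * onorm B (z' - z).
Proof.
move=> s_sub; have [Qz' _] := z'_min.
have := s_sub _ Qz'; have := model_subgradient Qz.
have := pairing_le B_sym B_pd s (- (z' - z)); rewrite onormN.
rewrite (d2f_sqr f_diff)// onorm_sqr//.
have -> : z' - x = (z - x) + (z' - z) by rewrite [RHS]addrC addrA subrK.
rewrite -(opprB z' z); move: (z' - z) (z - x) => d e.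
rewrite [B (e + d)]linearD/= !pairing_linear; lra.
Qed.
(** Without regularization and slope the step may be long, but then it stays in
    the kernel of the Hessian, where the gradient of [f] is constant. *)
Lemma newton_stationary s : dnorm B s <= 0 ->
  subgradient Q psir z (s - df z - (2 * M * g) *: B (z - x)) ->
  dnorm B (newton_residual df d2f z z') <= 0.
Proof.
move=> s_le /newton_decrease dec; have [Qz' _] := z'_min.
apply: le_trans
  (newton_residual_le B_sym B_pd Q_convex f_diff f_qsc (ltW M_gt0) Qz Qz') _.
rewrite mulr_ge0_le0 ?mulr_ge0 ?divr_ge0 ?expR_ge0 ?(ltW M_gt0)//.
have := mulr_le0_ge0 s_le (onorm_ge0 B (z' - z)).
have : 0 <= 2 * M * g * onorm B (z' - z) ^+ 2.
  by rewrite mulr_ge0 ?sqr_ge0// mulr_ge0// mulr_ge0// ltW.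
lra.
Qed.

(** With [|s| <= g] the step is so short that the exponential factor is at most
    [e^(1/2)], and the regularization converts [|d|_z^2] into [|s|^2 / (8 M g)].
    The resulting constant [e^(1/2) / 16] is below [e^(-2)]. *)
Lemma newton_contraction s : 0 < g -> dnorm B s <= g ->
  subgradient Q psir z (s - df z - (2 * M * g) *: B (z - x)) ->
  g * dnorm B (newton_residual df d2f z z') <= expR (- 2) * dnorm B s ^+ 2.
Proof.
move=> g_gt0 s_le /newton_decrease.
have [Qz' _] := z'_min.
have := newton_residual_le B_sym B_pd Q_convex f_diff f_qsc (ltW M_gt0) Qz Qz'.
set d := onorm B _; set u := onorm _ _ ^+ 2; set n := dnorm B s.
set r := dnorm _ _ => r_le dec.
have d0 : 0 <= d := onorm_ge0 _ _; have u0 : 0 <= u := sqr_ge0 _.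
have n0 : 0 <= n := dnorm_nonneg _ _.
have Md : M * d <= 1 / 2.
  have : 2 * M * g * d ^+ 2 <= g * d.
    by have := ler_wpM2r d0 (s_le : n <= g); lra.
  have [->|d_n0] := eqVneq d 0; first by lra.
  have d_gt0 : 0 < d by rewrite lt_def d_n0.
  rewrite expr2 mulrA ler_pM2r// -[leRHS]mulr1 -mulrA mulrCA ler_pM2l//.
  by lra.
have gu : g * M * u <= n ^+ 2 / 8.
  have := sqr_ge0 (n - 4 * (M * g * d)).
  have := ler_wpM2l (mulr_ge0 (ltW M_gt0) g_ge0) dec; lra.
have := expR_half_le R; set e2 := expR (- 2) => e2_le.
have e_le : expR (M * d) <= 16 * e2.
  by apply: le_trans e2_le; rewrite ler_expR.
apply: le_trans (ler_wpM2l (ltW g_gt0) r_le) _.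
have -> : g * (M / 2 * expR (M * d) * u) = expR (M * d) * (g * M * u) / 2.
  by field.
have e0 : 0 <= expR (M * d) := expR_ge0 _.
have gMu0 : 0 <= g * M * u by exact: mulr_ge0 (mulr_ge0 g_ge0 (ltW M_gt0)) u0.
have : expR (M * d) * (g * M * u) <= 16 * e2 * (n ^+ 2 / 8).
  exact: ler_pM.
lra.
Qed.

End Model.

(** Up to the perturbation [w], the primal image of [s / lambda], the vector
    [x - xs] is the sum of [x' - xs] and of [b], the primal image of
    [s' / lambda]. In the expansion of its square the cross term is
    [pairing s' (x' - xs)], up to a positive factor. *)
Lemma proximal_step (x x' xs : E) (s s' : dual E) (lambda e : R) :
    0 < lambda -> s' = s - lambda *: B (x' - x) ->
    dnorm B s <= lambda * e -> 0 <= pairing s' (x' - xs) ->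
  onorm B (x' - xs) ^+ 2 + (dnorm B s' / lambda) ^+ 2 <=
    (onorm B (x - xs) + e) ^+ 2.
Proof.
move=> l0 s'E s_le s'_ge0; have l_n0 : lambda != 0 by rewrite gt_eqF.
pose w := lambda^-1 *: (B^-1)%VF s; pose b := w - (x' - x).
have w_le : onorm B w <= e.
  rewrite onorm_scale gtr0_norm ?invr_gt0// -dnormE// mulrC.
  by rewrite ler_pdivrMr// mulrC.
have Bw : lambda *: B w = s.
  by rewrite [B w]linearZ/= BinvK// scalerA mulfV// scale1r.
have Bb : s' = lambda *: B b by rewrite s'E [B b]linearB/= scalerBr Bw.
have b_norm : dnorm B s' / lambda = onorm B b.
  by rewrite Bb dnorm_scale// dnorm_B// gtr0_norm// mulrAC mulfV// mul1r.
have ab : x - xs + w = (x' - xs) + 1 *: b.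
  by rewrite scale1r /b opprB addrCA [x' - xs + _]addrC subrKA [RHS]addrC.
have : onorm B (x - xs + w) ^+ 2 <= (onorm B (x - xs) + e) ^+ 2.
  have e0 : 0 <= e := le_trans (onorm_ge0 _ _) w_le.
  apply: lerXn2r; rewrite ?nnegrE ?onorm_ge0 ?addr_ge0 ?onorm_ge0//.
  by apply: le_trans (onorm_triangle _ _ _ _) _ => //; rewrite lerD2l.
apply: le_trans; rewrite b_norm ab !onorm_sqr// pairing_expand//.
move: s'_ge0; rewrite Bb pairingZl pmulr_rge0// B_sym; lra.
Qed.

End Step.

(** * Scalar recursions *)

Section Scalar.
Context {R : realType}.
Implicit Types (M r tau e g nu : R).

(** The decrease of the squared potential dominates [(g' / (2 M g))^2] because
    [tau'] multiplies [r + e - r'], which is nonnegative. The exponential comes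
    from [1 + y <= exp y] at [y = (g' / g)^2 - 1]. *)
Lemma outer_rate_step M r r' tau tau' e g g' :
    0 < M -> 0 < g -> 0 <= g' -> 0 <= r -> 0 <= r' -> 0 <= e -> 0 <= tau' ->
    e <= tau - tau' ->
    r' ^+ 2 + (g' / (2 * M * g)) ^+ 2 <= (r + e) ^+ 2 ->
  g' <= expR (2 * M ^+ 2 * ((r + tau) ^+ 2 - (r' + tau') ^+ 2) - 1 / 2) * g.
Proof.
move=> M0 g0 g'0 r0 r'0 e0 tau'0 e_tau prox; set D := _ - (_ + tau') ^+ 2.
set q := g' / _ in prox.
have r'_le : r' <= r + e.
  rewrite -(ler_pXn2r (n := 2)) ?nnegrE ?addr_ge0//.
  by apply: le_trans prox; rewrite lerDl sqr_ge0.
have qD : q ^+ 2 <= D.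
  have : (r + e + tau') ^+ 2 <= (r + tau) ^+ 2.
    by apply: lerXn2r; rewrite ?nnegrE ?addr_ge0//; lra.
  have : 0 <= tau' * (r + e - r') by rewrite mulr_ge0// subr_ge0.
  by rewrite /D; lra.
have -> : g' = 2 * M * q * g by rewrite /q; field; rewrite !gt_eqF.
rewrite ler_pM2r// -(ler_pXn2r (n := 2)) ?nnegrE ?expR_ge0//; last first.
  by rewrite /q !mulr_ge0 ?invr_ge0 ?mulr_ge0// ltW.
rewrite -expRM_natl; apply: le_trans (expR_ge1Dx _).
have -> : (2 * M * q) ^+ 2 = 4 * (M ^+ 2 * q ^+ 2) by ring.
have := ler_wpM2l (sqr_ge0 M) qD; lra.
Qed.

(** A closed form that stands for the tail of the series of the tolerances
    [nu / (k + 1)^2]: their sum from [k] on is at most [2 nu / (k + 1)]. *)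
Lemma tolerance_le_tail nu (k : nat) : 0 <= nu ->
  nu / k.+1%:R ^+ 2 <= 2 * nu / k.+1%:R - 2 * nu / k.+2%:R.
Proof.
move=> nu0; rewrite -(natr1 k.+1).
have : 1 <= k.+1%:R :> R by rewrite ler1n.
move: k.+1%:R => a a1; have a_gt0 : 0 < a by lra.
have -> : 2 * nu / a - 2 * nu / (a + 1) = nu / a ^+ 2 * (2 * a / (a + 1)).
  by field; rewrite !gt_eqF//; lra.
rewrite ler_peMr ?divr_ge0 ?exprn_ge0 ?(ltW a_gt0)//.
by rewrite ler_pdivlMr; lra.
Qed.

(** Bound on [|s_t| / g_k]. The recursion squares the ratio and multiplies it by
    [e^(-2)]: this is the exponent doubled for [t >= 1], and produces the first
    exponent from the ratio [1] at the start. *)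
Definition inner_rate (t : nat) : R :=
  if t is 0%N then 1 else expR (- (2 ^ t)%:R).

Lemma inner_rate_ge0 t : 0 <= inner_rate t.
Proof. by case: t => [|t]; rewrite ?ler01 ?expR_ge0. Qed.

Lemma inner_rate_le1 t : inner_rate t <= 1.
Proof. by case: t => [|t] //=; rewrite expR_le1 oppr_le0. Qed.

Lemma inner_rateS t : expR (- 2) * inner_rate t ^+ 2 <= inner_rate t.+1.
Proof.
case: t => [|t]; first by rewrite /inner_rate expn1 expr1n mulr1.
apply: (@le_trans _ _ (inner_rate t.+1 ^+ 2)).
  by rewrite ler_piMl ?sqr_ge0// expR_le1; lra.
rewrite /= -expRM_natl ler_expR (expnS 2 t.+1) natrM; lra.
Qed.

(** Solving [exp (- 2 ^ t) > eps] for [t]. *)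
Lemma inner_rate_log eps (X : R) t : (0 < t)%N -> 0 < eps -> eps^-1 <= X ->
  eps < inner_rate t -> t%:R <= (ln 2)^-1 * ln (ln X).
Proof.
case: t => // t _ eps0 epsX /=; rewrite expRN => eps_lt.
have t_lt : expR (2 ^ t.+1)%:R < X.
  apply: lt_le_trans epsX.
  by rewrite -[ltLHS]invrK ltf_pV2 ?posrE ?invr_gt0 ?expR_gt0.
have X0 : 0 < X by apply: lt_trans t_lt; exact: expR_gt0.
have pow_lt : (2 ^ t.+1)%:R < ln X by rewrite -ltr_expR lnK.
have pow0 : 0 < (2 ^ t.+1)%:R :> R by rewrite ltr0n expn_gt0.
have ln2 : 0 < ln (2 : R) by rewrite ln_gt0// ltr1n.
rewrite mulrC ler_pdivlMr// mulr_natl -lnXn// -natrX.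
by rewrite ler_ln ?posrE// ?(lt_trans pow0)// ltW.
Qed.

End Scalar.

(** * Invariants of the iteration *)

Section Method.
Context {R : realType} {E : vectType R}.
Variables (B : 'Hom(E, dual E)) (f : E -> R) (df : E -> dual E).
Variables (d2f : E -> 'Hom(E, dual E)) (d3f : E -> 'Hom(E, 'Hom(E, dual E))).
Variables (psi : E -> \bar R) (M nu : R) (x0 xstar : E) (dF0 : dual E).
Local Notation Q := (edom psi).
Local Notation psir := (fun x => fine (psi x)).
Hypothesis B_sym : self_adjoint B.
Hypothesis B_pd : positive_definite B.
Hypothesis psi_ccp : closed_convex_proper B psi.
Hypothesis f_convex : convex_function Q f.
Hypothesis f_diff : three_times_differentiable B Q f df d2f d3f.
Hypothesis f_qsc : quasi_self_concordant B Q d2f d3f M.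
Hypothesis M_gt0 : 0 < M.
Hypothesis nu_gt0 : 0 < nu.
Hypothesis xstar_sol : is_argmin Q (objective f psi) xstar.
Hypothesis x0_dom : Q x0.
Hypothesis dF0_sub : subdifferential (objective f psi) x0 dF0.

Local Notation reachable := (dnm_reachable B df d2f psi M nu x0 dF0).

(** The subgradient inequality of [F] at [x], read at [xstar], where [F] is
    smallest. *)
Lemma slope_monotone x s : Q x -> subgradient Q psir x (s - df x) ->
  0 <= pairing s (x - xstar).
Proof.
move=> Qx s_sub; have [Qs s_min] := xstar_sol.
have := s_min x Qx; rewrite /objective (edom_fineK psi_ccp Qs).
rewrite (edom_fineK psi_ccp Qx) -!EFinD lee_fin.
have := gradient_inequality psi_ccp f_convex f_diff Qx Qs.
have := s_sub _ Qs; rewrite -(opprB x xstar) !pairing_linear; lra.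
Qed.

Definition regularized_slope (g : R) (x z : E) (s : dual E) :=
  subgradient Q psir z (s - df z - (2 * M * g) *: B (z - x)).

Definition tolerance (g : R) (k : nat) : R := 2 * M * g * nu / k.+1%:R ^+ 2.

(** The slope [s_t] of the regularized objective is a residual of the method
    for [t > 0] and the outer slope for [t = 0]; it exceeds the tolerance as
    long as the inner loop goes on. *)
Definition inner_invariant (st : dnm_state E) : Prop :=
  exists2 s, regularized_slope (dnorm B (slope st)) (Defs.center st)
               (iterate st) s &
    dnorm B s <= inner_rate (inner st) * dnorm B (slope st) /\
    ((0 < inner st)%N -> tolerance (dnorm B (slope st)) (outer st) < dnorm B s).

(** When [g = 0] the model is not regularized, and the residual vanishes. *)
Lemma inner_step g x z z' t s : 0 <= g -> Q z ->
    is_argmin Q (newton_model B df d2f psi M g x z) z' ->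
    regularized_slope g x z s -> dnorm B s <= inner_rate t * g ->
  dnorm B (newton_residual df d2f z z') <= inner_rate t.+1 * g.
Proof.
move=> g_ge0 Qz z'_min s_sub s_le; have [g0|g_n0] := eqVneq g 0.
  rewrite g0 mulr0 in s_le; rewrite g0 mulr0.
  exact: (newton_stationary B_sym B_pd psi_ccp f_diff f_qsc M_gt0 g_ge0 Qz
    z'_min s_le s_sub).
have g_gt0 : 0 < g by rewrite lt_def g_n0.
have s_g : dnorm B s <= g.
  by apply: le_trans s_le _; rewrite ler_piMl ?inner_rate_le1.
rewrite -(ler_pM2l g_gt0); apply: le_trans
  (newton_contraction B_sym B_pd psi_ccp f_diff f_qsc M_gt0 g_ge0 Qz z'_min
    g_gt0 s_g s_sub) _.
apply: (@le_trans _ _ (expR (- 2) * (inner_rate t * g) ^+ 2)).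
  rewrite ler_wpM2l ?expR_ge0// lerXn2r// nnegrE ?dnorm_nonneg//.
  by rewrite mulr_ge0 ?inner_rate_ge0.
rewrite exprMn mulrA [leRHS]mulrCA -[g * g]expr2 ler_wpM2r ?sqr_ge0//.
exact: inner_rateS.
Qed.

Lemma regularized_slope_step g x z z' : Q z ->
    is_argmin Q (newton_model B df d2f psi M g x z) z' ->
  regularized_slope g x z' (newton_residual df d2f z z').
Proof.
move=> Qz z'_min; rewrite /regularized_slope addrAC.
exact: (step_subgradient B_sym B_pd psi_ccp f_diff Qz z'_min).
Qed.

Lemma regularized_slope_start g x s :
  subgradient Q psir x (s - df x) -> regularized_slope g x x s.
Proof. by rewrite /regularized_slope subrr linear0 scaler0 subr0. Qed.

Lemma reachable_invariant st : reachable st ->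
  [/\ Q (Defs.center st), Q (iterate st) & inner_invariant st].
Proof.
elim=> {st} [|k x dF t z N z' _ [Qx Qz [s s_sub [s_le _]]] _ z'_min tol
  |k x dF t z N z' _ [Qx Qz _] _ z'_min _].
- split=> //; exists dF0; last by rewrite /= mul1r.
  apply: regularized_slope_start.
  exact: (subdifferential_subgradient psi_ccp f_diff).
- split=> //=; first by case: z'_min.
  exists (newton_residual df d2f z z') => /=.
    exact: regularized_slope_step.
  by split=> [|_//]; apply: inner_step s_sub s_le => //; exact: dnorm_nonneg.
- have [Qz' _] := z'_min; split=> //; eexists.
    apply: regularized_slope_start.
    exact: (step_subgradient B_sym B_pd psi_ccp f_diff Qz z'_min).
  by rewrite /= mul1r.
Qed.

Definition potential (st : dnm_state E) : R :=
  onorm B (Defs.center st - xstar) + 2 * nu / (outer st).+1%:R.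

(** The potential drops from [|x0 - x*| + 2 nu], and each outer iteration pays
    for its contraction with the decrease of the squared potential. *)
Lemma slope_decay st : reachable st ->
  dnorm B (slope st) <=
    expR (2 * M ^+ 2 *
            ((onorm B (x0 - xstar) + 2 * nu) ^+ 2 - potential st ^+ 2)
          - (outer st)%:R / 2) * dnorm B dF0.
Proof.
elim=> {st} [//|//|k x dF t z N z' st_reach IH _ z'_min tol].
  by rewrite /potential /= divr1 subrr mulr0 mul0r subr0 expR0 mul1r.
have [_ Qz _] := reachable_invariant st_reach; have [Qz' _] := z'_min.
move: IH; rewrite /potential /=.
set s' := _ - _ *: B _; set g := dnorm B dF; set g' := dnorm B s'.
have g'0 : 0 <= g' := dnorm_nonneg B _.
have [g0|g_n0] := eqVneq g 0.
  (* The tolerance is zero, and so is the new slope. *)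
  move=> _; apply: (@le_trans _ _ 0).
    by move: tol; rewrite /g' /s' -/g g0 !(mulr0, mul0r) scale0r subr0.
  by rewrite mulr_ge0 ?expR_ge0 ?dnorm_nonneg.
have g_gt0 : 0 < g by rewrite lt_def g_n0 dnorm_nonneg.
pose e := nu / k.+1%:R ^+ 2; set r := onorm B (x - xstar).
have s'_mono : 0 <= pairing s' (z' - xstar).
  apply: slope_monotone => //.
  exact: (step_subgradient B_sym B_pd psi_ccp f_diff Qz z'_min).
have lambda0 : 0 < 2 * M * g by rewrite !mulr_gt0.
have s_le : dnorm B (newton_residual df d2f z z') <= 2 * M * g * e.
  by rewrite /e mulrA.
have prox := proximal_step B_sym B_pd lambda0 erefl s_le s'_mono.
have nu0 := ltW nu_gt0.
have := outer_rate_step M_gt0 g_gt0 g'0 (onorm_ge0 _ _) (onorm_ge0 _ _) _ _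
  (tolerance_le_tail k nu0) prox.
rewrite -/r !divr_ge0 ?mulr_ge0 ?exprn_ge0// => /(_ isT isT) g'_le g_le.
apply: le_trans g'_le _; apply: le_trans (ler_wpM2l (expR_ge0 _) g_le) _.
rewrite mulrA -expRD ler_wpM2r ?dnorm_nonneg// ler_expR.
set p := (r + _) ^+ 2; set q := (_ + _ / k.+2%:R) ^+ 2; clearbody p q.
by rewrite -[k.+1%:R]natr1; lra.
Qed.

Section CallCount.
Variables (K : nat) (X : R).
Hypothesis X_def : X = K.+1%:R ^+ 2 / (2 * M * nu).
Hypothesis X_ge : expR 1 <= X.

Let b : R := (ln 2)^-1 * ln (ln X).

Lemma log_log_ge0 : 0 <= b.
Proof.
have lnX1 : 1 <= ln X.
  by rewrite -(expRK 1) ler_ln ?posrE ?expR_gt0// (lt_le_trans (expR_gt0 1)).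
by rewrite mulr_ge0 ?invr_ge0 ?ln_ge0// ler1n.
Qed.

(** The residual of the last step is above the tolerance and below its
    guaranteed size, which limits the number of steps. *)
Lemma inner_count st : reachable st -> (started st <= K)%N ->
  (inner st)%:R <= b.
Proof.
move=> /reachable_invariant[_ _ [s _ [s_le s_gt]]].
rewrite /started; case: posnP => [->|t0]; first by rewrite log_log_ge0.
rewrite addn1 => kK; have := lt_le_trans (s_gt t0) s_le.
set g := dnorm B _ => tol.
have g_gt0 : 0 < g.
  rewrite lt_def dnorm_nonneg andbT; apply/eqP => g0.
  by move: tol; rewrite /tolerance g0 !(mulr0, mul0r) ltxx.
have Mnu0 : 0 < 2 * M * nu by rewrite !mulr_gt0.
apply: (inner_rate_log (eps := 2 * M * nu / (outer st).+1%:R ^+ 2)) => //.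
- by rewrite divr_gt0 ?exprn_gt0 ?ltr0n.
- rewrite invf_div X_def ler_wpM2r ?invr_ge0 ?(ltW Mnu0)//.
  by apply: lerXn2r; rewrite ?nnegrE ?ler0n// ler_nat (leq_trans kK).
- rewrite -(ltr_pM2r g_gt0); apply: le_lt_trans tol.
  by rewrite /tolerance [leLHS]mulrAC [2 * M * nu * g]mulrAC.
Qed.

(** Each completed iteration is charged [1 + b]: the steps that missed the
    tolerance, at most [b] of them, and the one that met it. *)
Lemma call_count st : reachable st -> (started st <= K)%N ->
  (calls st)%:R <= (outer st)%:R * (1 + b) + (inner st)%:R.
Proof.
elim=> {st} [_|k x dF t z N z' st_reach IH _ _ _ kK
  |k x dF t z N z' st_reach IH _ _ _ kK] /=.
- by rewrite mul0r addr0.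
- have : (started (DnmState k x dF t z N) <= K)%N.
    by apply: leq_trans kK; rewrite leq_add2l; case: (0 < t)%N.
  by move=> /IH /=; rewrite -!natr1; lra.
- have st_le : (started (DnmState k x dF t z N) <= K)%N.
    apply: leq_trans kK.
    by rewrite /started /= addn0 -[k.+1]addn1 leq_add2l leq_b1.
  have := IH st_le; have := inner_count st_reach st_le.
  by rewrite /= -!natr1; lra.
Qed.

Lemma total_calls st : reachable st -> (started st <= K)%N ->
  (calls st)%:R <= K%:R * (1 + b).
Proof.
move=> st_reach st_le; apply: le_trans (call_count st_reach st_le) _.
have b0 := log_log_ge0; have inner_b := inner_count st_reach st_le.
apply: (@le_trans _ _ ((started st)%:R * (1 + b))); last first.
  by rewrite ler_wpM2r ?addr_ge0// ler_nat.
by move: inner_b; rewrite /started natrD; case: (inner st) => [|t] /=; lra.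
Qed.

End CallCount.

End Method.

(** * Linear rate and number of oracle calls *)

(* N_k >= k forces the double logarithm in the bound on N_k to be nonnegative;
   the premise [expR 1 <= _] says exactly that. *)
Theorem theorem5p2 (R : realType) (E : vectType R) (B : 'Hom(E, dual E))
  (f : E -> R) (df : E -> dual E) (d2f : E -> 'Hom(E, dual E))
  (d3f : E -> 'Hom(E, 'Hom(E, dual E))) (psi : E -> \bar R)
  (M nu : R) (x0 xstar : E) (dF0 : dual E)
  (B_sym : self_adjoint B) (B_pd : positive_definite B)
  (psi_ccp : closed_convex_proper B psi)
  (f_convex : convex_function (edom psi) f)
  (f_diff : three_times_differentiable B (edom psi) f df d2f d3f)
  (f_qsc : quasi_self_concordant B (edom psi) d2f d3f M)
  (M_gt0 : 0 < M) (nu_gt0 : 0 < nu)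
  (xstar_sol : is_argmin (edom psi) (objective f psi) xstar)
  (x0_dom : edom psi x0)
  (dF0_sub : subdifferential (objective f psi) x0 dF0) :
  (forall st : dnm_state E,
     dnm_reachable B df d2f psi M nu x0 dF0 st ->
     (1 <= outer st)%N ->
     dnorm B (slope st) <=
       expR (2 * M ^+ 2 * (onorm B (x0 - xstar) + 2 * nu) ^+ 2
             - (outer st)%:R / 2) * dnorm B dF0)
  /\
  (forall (k : nat) (st : dnm_state E),
     (1 <= k)%N ->
     dnm_reachable B df d2f psi M nu x0 dF0 st ->
     (started st <= k)%N ->
     expR 1 <= (k.+1)%:R ^+ 2 / (2 * M * nu) ->
     (calls st)%:R <=
       k%:R * (1 + (ln 2)^-1 * ln (ln ((k.+1)%:R ^+ 2 / (2 * M * nu))))).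
Proof.
split=> [st st_reach _|k st _ st_reach st_k X_ge]; last first.
  exact: (total_calls B_sym B_pd psi_ccp f_diff f_qsc M_gt0 nu_gt0 x0_dom
    dF0_sub erefl X_ge st_reach st_k).
apply: le_trans (slope_decay B_sym B_pd psi_ccp f_convex f_diff f_qsc M_gt0
  nu_gt0 xstar_sol x0_dom dF0_sub st_reach) _.
rewrite ler_wpM2r ?dnorm_nonneg// ler_expR lerD2r.
rewrite ler_wpM2l ?mulr_ge0 ?exprn_ge0 ?(ltW M_gt0)//.
by rewrite lerBlDr lerDl sqr_ge0.
Qed.
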